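(* Let $l\ge1$ be an integer and let $f:[0,1]\to[0,1]$ be a $C^l$ $l$-multimodal map. Then for any $0<\varepsilon<1$, $$h^*(f,\varepsilon)\le\frac{\log^+\|f\|_l}{|\log\varepsilon|}.$$
   Context: A multimodal map is a continuous map $f:[0,1]\to[0,1]$ which is piecewise monotone with finitely many pieces. It is $l$-multimodal if $[0,1]$ may be subdivided into $l$, and not more, intervals of monotonicity of $f$ (so $l$ is the number of intervals of the minimal partition into intervals of monotonicity). For a $C^l$ map, $\|f\|_l=\max_{1\le k\le l}\|f^{(k)}\|_\infty$ (the function itself is not included). $\log^+x=\max(\log x,0)$. Tail entropy (with $d(x,y)=|x-y|$ on $[0,1]$): $B_n(f,x,\varepsilon)=\{y: d(f^iy,f^ix)<\varepsilon,\ 0\le i\le n-1\}$; $r_n(f,\Lambda,\delta)$ is the smallest cardinality of a set $K\subset[0,1]$ such that for every $x\in\Lambda$ there is $y\in K$ with $d(f^ix,f^iy)<\delta$ for $0\le i\le n-1$; and $$h^*(f,\varepsilon)=\lim_{\delta\to0}\limsup_{n\to\infty}\frac1n\log\sup_{x\in[0,1]} r_n(f,B_n(f,x,\varepsilon),\delta).$$ *)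

(* Defs.v *)
From mathcomp Require Export all_boot all_order all_algebra.
From mathcomp Require Export all_classical all_reals all_analysis.

Set Implicit Arguments.
Unset Strict Implicit.
Unset Printing Implicit Defensive.

Export Order.TTheory GRing.Theory Num.Theory.
Export numFieldNormedType.Exports.

Local Open Scope classical_set_scope.
Local Open Scope ring_scope.

(* A map of the unit interval into itself is represented by a function
   f : R -> R that sends [0, 1] into [0, 1].  Every notion below depends on
   the values of f on [0, 1] only; in particular the derivatives at 0 and 1
   are one-sided. *)

Section UnitInterval.
Context {R : realType}.
Implicit Types (f : R -> R) (x eps delta : R) (A : set R) (n k l : nat).

Definition itv_self_map f := forall x, x \in `[0, 1] -> f x \in `[0, 1].

(* The limit of the difference quotient at x is taken along the points y != x
   of [0, 1]. *)
Definition derivable_itv f x :=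
  cvg ((f y - f x) / (y - x) @[y --> within `[0, 1] x^']).

Definition derive_itv f x : R :=
  lim ((f y - f x) / (y - x) @[y --> within `[0, 1] x^']).

Definition deriven_itv k f : R -> R := iter k derive_itv f.

Definition is_C l f :=
  (forall k, (k < l)%N ->
     forall x, x \in `[0, 1] -> derivable_itv (deriven_itv k f) x) /\
  {within `[0, 1], continuous (deriven_itv l f)}.

Definition sup_norm f : R := sup [set `|f x| | x in `[0, 1]].

(* The neutral element 0 is harmless since the sup norms are nonnegative. *)
Definition C_norm l f : R :=
  \big[Num.max/0]_(1 <= k < l.+1) sup_norm (deriven_itv k f).

Definition monotone_on f (a b : R) :=
  {in `[a, b] &, nondecreasing_fun f} \/ {in `[a, b] &, nonincreasing_fun f}.

(* s lists the right end-points of the pieces, so there are [size s] of them. *)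
Definition monotone_partition f (s : seq R) :=
  itv_partition 0 1 s /\
  forall i, (i < size s)%N -> monotone_on f (nth 0 (0 :: s) i) (nth 0 s i).

Definition multimodal l f :=
  [/\ {within `[0, 1], continuous f},
      exists2 s, monotone_partition f s & size s = l
    & forall s, monotone_partition f s -> (l <= size s)%N].

Definition bowen_ball n f x eps : set R :=
  [set y | y \in `[0, 1] /\
     forall i, (i < n)%N -> `|iter i f y - iter i f x| < eps].

Definition spanning n f A delta (K : set R) :=
  K `<=` `[0, 1] /\
  forall x, A x -> exists2 y, K y &
    forall i, (i < n)%N -> `|iter i f x - iter i f y| < delta.

(* Extended-real valued, being +oo when there is no finite spanning set. *)
Definition span_card n f A delta : \bar R :=
  ereal_inf [set (m%:R)%:E | m in
    [set m | exists K : set R, (K #= `I_m)%card /\ spanning n f A delta K]].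

Definition tail_entropy f eps : \bar R :=
  lim (limn_esup (fun n : nat =>
         (n%:R^-1)%:E *
         lne (ereal_sup [set span_card n f (bowen_ball n f x eps) delta
                        | x in `[0%R, 1%R]]))%E
       @[delta --> 0^'+]).

Definition ln_plus x : R := Num.max (ln x) 0.

End UnitInterval.

(* Main.v *)
Require Import Defs.
From mathcomp Require Import ring lra zify.
From mathcomp Require finmap.

(** The tail entropy counts how many orbits stay within [eps] of a given one
    and are still [delta]-distinguishable.  Let [S_i] be the i-th image of a
    Bowen ball, [ell_i <= eps] half the length of its convex hull, and [k_i] the
    number of monotonicity pieces of [f] that this hull meets.  Points with the
    same itinerary through the pieces move monotonically under every iterate,
    so the orbits of one itinerary need only linearly many representatives
    ([covered_monotone]), and it remains to bound the product of the [k_i].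

    Each of the [k_i - 1] piece boundaries in the hull is a zero of [f'],
    because the minimal partition alternates increasing and decreasing pieces
    ([cut_critical]).  Since [k_i <= l], Lagrange interpolation of [f'] at these
    zeros makes [f] a strong contraction on the hull, with [M] the larger of [1]
    and the C^l norm ([half_image_le]):
    [ell_(i+1) <= M * ell_i ^ k_i].
    The distance to the centre is at most [eps] while the diameter may reach
    [2 * eps]; working with half-lengths loses nothing, because the factorials
    of the interpolation formula pay for the powers of 2.

    Put [alpha_i = - ln ell_i], which is at least [- ln eps].  Then
    [k_i * alpha_i <= alpha_(i+1) + ln M
                   <= alpha_(i+1) * exp (ln M / |ln eps|)],
    and the product of the [k_i] over [i < N] is at most
    [alpha_N / alpha_0 * exp (N * ln M / |ln eps|)] ([prod_exponents_le]).
    Take for [N] the last time at which the image of the ball has length at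
    least [delta]: later times distinguish nothing, and [alpha_N] is bounded in
    terms of [delta] alone ([covered_bowen_ball]).  So the growth rate of the
    spanning numbers is at most [ln M / |ln eps|] for every [delta]. *)

Set Implicit Arguments.
Unset Strict Implicit.
Unset Printing Implicit Defensive.

Local Open Scope classical_set_scope.
Local Open Scope ring_scope.

(** * Differentiability on the closed unit interval *)

Section OneSidedDerivative.
Context {R : realType}.
Implicit Types (f : R -> R) (x : R).

Lemma derivable_itv_near f x : x \in `[0, 1] -> derivable_itv f x ->
  forall e, 0 < e -> exists2 d, 0 < d &
    forall y, y \in `[0, 1] -> y != x -> `|y - x| < d ->
      `|derive_itv f x - (f y - f x) / (y - x)| < e.
Proof.
move=> x01 df e e0.
have /cvgrPdist_lt/(_ _ e0) : (f y - f x) / (y - x) @[y --> within `[0, 1] x^']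
  --> derive_itv f x by exact: df.
case=> d /= d0 h; exists d => // y y01 yx yd.
by apply: h => //=; rewrite distrC.
Qed.

Lemma derivable_itv_continuous f :
  (forall x, x \in `[0, 1] -> derivable_itv f x) ->
  {within `[0, 1], continuous f}.
Proof.
move=> df; apply/subspace_continuousP => x /= x01.
have [d d0 hd] := derivable_itv_near x01 (df x x01) ltr01.
apply/cvgrPdist_lt => e e0.
set K := `|derive_itv f x| + 1.
have K0 : 0 < K by rewrite ltr_wpDl.
have m0 : 0 < Num.min d (e / K) by rewrite lt_min d0 divr_gt0.
exists (Num.min d (e / K)); first exact: m0.
move=> y; rewrite /= lt_min => /andP[yd ye] y01.
have [->|yx] := eqVneq y x; first by rewrite subrr normr0.
have q := hd y y01 yx; rewrite distrC in yd; have {}q := q yd.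
have yx0 : y - x != 0 by rewrite subr_eq0.
have -> : f x - f y = - ((f y - f x) / (y - x)) * (y - x) by field.
rewrite normrM normrN.
have qK : `|(f y - f x) / (y - x)| < K.
  rewrite /K -ltrBlDl; apply: le_lt_trans q.
  by rewrite distrC; exact: lerB_dist.
have yx1 : 0 < `|y - x| by rewrite normr_gt0.
have : `|(f y - f x) / (y - x)| * `|y - x| < K * `|y - x| by rewrite ltr_pM2r.
move/lt_trans; apply.
by rewrite mulrC -ltr_pdivlMr // distrC.
Qed.

Lemma derivable_itv_is_derive f x : x \in `]0, 1[ -> derivable_itv f x ->
  is_derive x (1 : R) f (derive_itv f x).
Proof.
rewrite in_itv /= => /andP[x0 x1] df.
have x01 : x \in `[0, 1] by rewrite in_itv /= !ltW.
suff h : h^-1 *: ((f \o shift x) (h *: (1:R)) - f x) @[h --> (0:R)^'] --> derive_itv f x.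
  apply: DeriveDef; first by apply/cvg_ex; exists (derive_itv f x).
  exact/cvg_lim.
apply/cvgrPdist_lt => e e0.
have [d d0 hd] := derivable_itv_near x01 df e0.
have m0 : 0 < Num.min d (Num.min x (1 - x)) by rewrite !lt_min d0 x0 subr_gt0.
exists (Num.min d (Num.min x (1 - x))); first exact: m0.
move=> h /=.
rewrite sub0r normrN !lt_min => /and3P[hd' hx hx1] h0.
have := hd (h + x).
rewrite addrK -subr_eq0 addrK in_itv /= => /(_ _ h0 hd').
rewrite [h *: _]mulr1 mulrC; apply.
by move: hx hx1; rewrite !ltr_norml => /andP[? ?] /andP[? ?]; apply/andP; split; lra.
Qed.

End OneSidedDerivative.

(** * Interpolation of a function at zeros of its derivative *)

Section Interpolation.
Context {R : realType}.
Implicit Types (a b c x y z : R) (s u : seq R) (m i : nat).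

Lemma subset_segment a b x y : x \in `[a, b] -> y \in `[a, b] ->
  {subset `[x, y] <= `[a, b]}.
Proof.
rewrite !in_itv /= => /andP[ax _] /andP[_ yb] t; rewrite !in_itv /=.
by move=> /andP[xt ty]; rewrite (le_trans ax) // (le_trans ty).
Qed.

Lemma subset_open_segment a b x y : x \in `[a, b] -> y \in `[a, b] ->
  {subset `]x, y[ <= `]a, b[}.
Proof.
rewrite !in_itv /= => /andP[ax _] /andP[_ yb] t; rewrite !in_itv /=.
by move=> /andP[xt ty]; rewrite (le_lt_trans ax) // (lt_le_trans ty).
Qed.

Lemma rolle_zeros (h dh : R -> R) a b x s :
  (forall t, t \in `]a, b[ -> is_derive t (1 : R) h (dh t)) ->
  {within `[a, b], continuous h} ->
  path <%R x s -> all [in `[a, b]] (x :: s) -> all (fun t => h t == 0) (x :: s) ->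
  exists s', [/\ size s' = size s, path <%R x s',
    all [in `[a, b]] s' & all (fun t => dh t == 0) s'].
Proof.
move=> hd hc; elim: s x => [|y s ih] x; first by exists [::].
move=> /= /andP[xy ys] /and3P[xab yab sab] /and3P[/eqP hx /eqP hy hs].
have [||s' [sz pys sab' hs']] := ih y ys; first by rewrite /= yab.
  by rewrite /= hy eqxx.
have subs := subset_segment xab yab; have subo := subset_open_segment xab yab.
have [t txy [_ ht]] : exists2 t, t \in `]x, y[ & is_derive t (1 : R) h 0.
  apply: Rolle => //; last by rewrite hx hy.
  - by move=> t /subo/hd [].
  - by apply: continuous_subspaceW hc => t /subs.
have tab := subset_itv_oo_cc txy; have [_ hdt] := hd t (subo _ txy).
exists (t :: s'); split => //=; first by rewrite sz.
- move: txy; rewrite in_itv /= => /andP[-> ty] /=.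
  by apply: path_le pys => //; exact: lt_trans.
- by rewrite subs.
- by rewrite hs' -hdt ht eqxx.
Qed.

(** Each application of Rolle's theorem loses exactly one zero. *)
Lemma rolle_iter (g : nat -> R -> R) a b m s :
  (forall i, (i < m)%N -> forall t, t \in `]a, b[ ->
     is_derive t (1 : R) (g i) (g i.+1 t)) ->
  (forall i, (i < m)%N -> {within `[a, b], continuous (g i)}) ->
  size s = m.+1 -> sorted <%R s ->
  all [in `[a, b]] s -> all (fun t => g 0 t == 0) s ->
  exists2 t, t \in `[a, b] & g m t = 0.
Proof.
elim: m g s => [|m ih] g [//|x s] hd hc /= [sz] ps sab hs.
  by move: sab hs => /andP[xab _] /andP[/eqP ? _]; exists x.
have [s' [sz' ps' sab' hs']] := rolle_zeros (hd 0%N isT) (hc 0%N isT) ps sab hs.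
apply: (ih (fun i => g i.+1) s') => //.
- by move=> i im; exact: hd.
- by move=> i im; exact: hc.
- by rewrite sz'.
- exact: path_sorted ps'.
Qed.

Lemma derivn_prod_XsubC (s : seq R) (t : R) :
  ((\prod_(c <- s) ('X - c%:P))^`(size s)).[t] = (size s)`!%:R.
Proof.
set p := \prod_(c <- s) _.
have sp : size p = (size s).+1 by rewrite size_prod_XsubC.
have -> : p^`(size s) = (size s)`!%:R%:P.
  apply/polyP => i; rewrite coef_derivn coefC; case: i => [|i] /=.
    rewrite addn0 ffactnn; suff -> : p`_(size s) = 1 by [].
    have := monic_prod_XsubC s xpredT id; rewrite -/p monicE lead_coefE sp /=.
    by move/eqP.
  by rewrite nth_default ?mul0rn // sp addnS ltnS leq_addr.
by rewrite hornerC.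
Qed.

(** Error bound of Lagrange interpolation by the zero polynomial at the zeros
    of [g 0].  Subtracting the multiple of [prod (X - c)] that agrees with
    [g 0] at the further point [y] creates one zero more, and iterated Rolle
    finds a zero of the derivative of order [size s] of the difference. *)
Lemma interpolation_bound (g : nat -> R -> R) a b M s y :
  (forall i, (i < size s)%N -> forall t, t \in `]a, b[ ->
     is_derive t (1 : R) (g i) (g i.+1 t)) ->
  (forall i, (i < size s)%N -> {within `[a, b], continuous (g i)}) ->
  (forall t, t \in `[a, b] -> `|g (size s) t| <= M) ->
  uniq s -> all [in `[a, b]] s -> all (fun t => g 0 t == 0) s ->
  y \in `[a, b] ->
  `|g 0 y| <= M / (size s)`!%:R * \prod_(c <- s) `|y - c|.
Proof.
move=> hd hc hM us sab hs yab.
have f0 : (0 : R) < (size s)`!%:R by rewrite ltr0n fact_gt0.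
have M0 : 0 <= M by apply: le_trans (hM y yab).
have [ys|ys] := boolP (y \in s).
  have /eqP -> := allP hs y ys.
  by rewrite normr0; apply: mulr_ge0; [exact: divr_ge0|exact: prodr_ge0].
set p := \prod_(c <- s) ('X - c%:P).
have py : p.[y] = \prod_(c <- s) (y - c).
  by rewrite horner_prod; apply: eq_bigr => c _; rewrite !hornerE.
have p0 : p.[y] != 0.
  rewrite py prodf_seq_neq0; apply/allP => c cs /=; rewrite subr_eq0.
  by apply: contraNneq ys => ->.
pose k := g 0 y / p.[y].
pose G i t := g i t - k * (p^`(i)).[t].
have dG i : (i < size s)%N -> forall t, t \in `]a, b[ ->
    is_derive t (1 : R) (G i) (G i.+1 t).
  move=> im t tab; have hgi := hd i im t tab.
  have -> : G i = g i - k \*: (fun t => (p^`(i)).[t]) by apply/funext.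
  have hp := is_derive_poly p^`(i) t.
  apply: is_derive_eq; rewrite /G derivnS //.
have cG i : (i < size s)%N -> {within `[a, b], continuous (G i)}.
  move=> im t; apply: cvgB; first exact: hc.
  apply: cvgMl_tmp; apply: continuous_subspaceT => z; exact: continuous_horner.
have [||||t tab] := rolle_iter dG cG (s := sort <=%R (y :: s)).
- by rewrite size_sort.
- by rewrite sort_lt_sorted /= ys.
- by rewrite all_sort /= yab.
- rewrite all_sort /= {1}/G derivn0 divfK // subrr eqxx /=.
  apply/allP => c cs; rewrite /G derivn0.
  have /eqP -> := allP hs c cs.
  suff -> : p.[c] = 0 by rewrite mulr0 subrr.
  by apply/eqP; rewrite -[_ == _]/(root p c) root_prod_XsubC.
rewrite /G derivn_prod_XsubC => /eqP; rewrite subr_eq0 => /eqP gk.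
have -> : g 0 y = g (size s) t / (size s)`!%:R * p.[y].
  by rewrite gk /k; field; rewrite p0 gt_eqF.
rewrite normrM py normr_prod normrM normfV (gtr0_norm f0).
apply: ler_wpM2r; first exact: prodr_ge0.
by apply: ler_wpM2r; [rewrite invr_ge0 ltW|exact: hM].
Qed.

End Interpolation.

Section Oscillation.
Context {R : realType}.
Implicit Types (a b c x y z K M : R) (s : seq R).

(** Cauchy's mean value theorem against [(t - c)^2], whose derivative does not
    vanish between [y] and [z]. *)
Lemma increment_one_side (f df : R -> R) y z c K :
  y < z -> c \notin `]y, z[ ->
  (forall t, t \in `]y, z[ -> is_derive t (1 : R) f (df t)) ->
  {within `[y, z], continuous f} ->
  (forall t, t \in `]y, z[ -> `|df t| <= K * `|t - c|) ->
  `|f z - f y| <= K / 2 * `|(z - c) ^+ 2 - (y - c) ^+ 2|.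
Proof.
move=> yz cyz hd hc hK.
pose q : {poly R} := ('X - c%:P) ^+ 2.
have qE t : q.[t] = (t - c) ^+ 2 by rewrite /q horner_exp !hornerE.
have dqE t : q^`().[t] = 2 * (t - c).
  by rewrite /q expr2 derivM derivXsubC mulr1 mul1r hornerD hornerXsubC; ring.
pose D := (z - c) ^+ 2 - (y - c) ^+ 2.
pose F t := D * f t - (f z - f y) * q.[t].
have dF t : t \in `]y, z[ -> is_derive t (1 : R) F (D * df t - (f z - f y) * q^`().[t]).
  move=> tyz; have := hd t tyz => hft.
  have -> : F = D \*: f - (f z - f y) \*: horner q by apply/funext.
  by have hp := is_derive_poly q t; apply: is_derive_eq.
have cF : {within `[y, z], continuous F}.
  move=> t; apply: cvgB; first by apply: cvgMl_tmp; exact: hc.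
  apply: cvgMl_tmp; apply: continuous_subspaceT => u; exact: continuous_horner.
have [t tyz] := MVT yz dF cF.
rewrite /F !qE dqE.
have -> : D * f z - (f z - f y) * (z - c) ^+ 2 -
  (D * f y - (f z - f y) * (y - c) ^+ 2) = 0 by rewrite /D; ring.
move/esym/eqP; rewrite mulf_eq0 [z - y == 0]subr_eq0 (gt_eqF yz) orbF subr_eq0.
move/eqP => E.
have tc : 0 < `|t - c|.
  by rewrite normr_gt0 subr_eq0; apply: contraNneq cyz => <-.
rewrite -(ler_pM2r tc) -[(z - c) ^+ 2 - _]/D -normrM.
have -> : (f z - f y) * (t - c) = (D * df t) / 2 by rewrite E; field.
rewrite normrM normrM normfV (ger0_norm (_ : 0 <= 2)) //.
have -> : K / 2 * `|D| * `|t - c| = `|D| * (K * `|t - c|) / 2 by ring.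
by rewrite ler_pM2r ?invr_gt0 //; apply: ler_wpM2l => //; exact: hK.
Qed.

(** If [c] separates [y] and [z], the increments on its two sides add up:
    [(y - c)^2 + (z - c)^2 <= (b - a)^2].  This gains the factor 1/2 over the
    mean value inequality. *)
Lemma increment_le_sqr (f df : R -> R) a b c K y z :
  0 <= K -> c \in `[a, b] ->
  (forall t, t \in `]a, b[ -> is_derive t (1 : R) f (df t)) ->
  {within `[a, b], continuous f} ->
  (forall t, t \in `]a, b[ -> `|df t| <= K * `|t - c|) ->
  y \in `[a, b] -> z \in `[a, b] -> `|f z - f y| <= K / 2 * (b - a) ^+ 2.
Proof.
move=> K0 cab hd hc hK; wlog yz : y z / y <= z.
  move=> wl yab zab; have [|/ltW] := leP y z; first by move/wl; exact.
  by move/wl => /(_ zab yab); rewrite distrC.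
move=> yab zab; move: (cab) (yab) (zab); rewrite !in_itv /=.
move=> /andP[ac cb] /andP[ay yb] /andP[az zb].
have K20 : 0 <= K / 2 by rewrite divr_ge0.
have [-> |yz'] := eqVneq y z.
  by rewrite subrr normr0 mulr_ge0 // sqr_ge0.
have {yz'} yz : y < z by rewrite lt_neqAle yz'.
have one_side u v : u \in `[a, b] -> u < v -> v \in `[a, b] -> c \notin `]u, v[ ->
    `|f v - f u| <= K / 2 * `|(v - c) ^+ 2 - (u - c) ^+ 2|.
  move=> uab uv vab cuv.
  have so := subset_open_segment uab vab; have sc := subset_segment uab vab.
  have := @increment_one_side f df u v c K uv cuv.
  move=> /(_ (fun t tuv => hd t (so t tuv)) (continuous_subspaceW sc hc)).
  exact (fun k => k (fun t tuv => hK t (so t tuv))).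
have [cyz|cyz] := boolP (c \in `]y, z[); last first.
  apply: le_trans (one_side y z yab yz zab cyz) _.
  apply: ler_wpM2l => //; rewrite ler_norml; apply/andP; split; nra.
move: cyz; rewrite in_itv /= => /andP[yc cz].
have h1 := one_side y c yab yc cab; have h2 := one_side c z cab cz zab.
rewrite !in_itv /= !ltxx ?andbF /= in h1 h2.
have {}h1 := h1 isT; have {}h2 := h2 isT.
rewrite subrr expr0n /= sub0r normrN (ger0_norm (sqr_ge0 _)) in h1.
rewrite subrr expr0n /= subr0 (ger0_norm (sqr_ge0 _)) in h2.
have -> : f z - f y = (f z - f c) + (f c - f y) by ring.
apply: le_trans (ler_normD _ _) _; apply: le_trans (lerD h2 h1) _.
rewrite -mulrDr; apply: ler_wpM2l => //; nra.
Qed.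

Lemma exp2_le_double_fact m : (0 < m)%N -> (2 ^ m <= 2 * m`!)%N.
Proof.
case: m => // m _; elim: m => // m ih.
rewrite expnS factS mulnCA leq_mul //.
Qed.

(** Interpolating [g 1] at its [m] zeros and integrating once gives an image of
    length at most [M L^(m+1) / (2 m!)].  Passing from lengths to half-lengths
    costs [2^m], which [2 m!] covers. *)
Lemma half_image_le (g : nat -> R -> R) a b M s y z :
  (forall i, (i <= size s)%N -> forall t, t \in `]a, b[ ->
     is_derive t (1 : R) (g i) (g i.+1 t)) ->
  (forall i, (i <= size s)%N -> {within `[a, b], continuous (g i)}) ->
  (forall t, t \in `[a, b] -> `|g (size s).+1 t| <= M) ->
  uniq s -> all [in `[a, b]] s -> all (fun t => g 1%N t == 0) s ->
  y \in `[a, b] -> z \in `[a, b] ->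
  `|g 0 z - g 0 y| / 2 <= M * ((b - a) / 2) ^+ (size s).+1.
Proof.
move=> hd hc hM us sab hs yab zab.
have M0 : 0 <= M by apply: le_trans (hM y yab).
have L0 : 0 <= b - a by move: yab; rewrite in_itv /= => /andP[? ?]; lra.
case: s => [|c s] in hd hc hM us sab hs *.
  (* Without zeros this is the mean value inequality. *)
  wlog yz : y z yab zab / y <= z.
    move=> wl; have [|/ltW] := leP y z; first by move/wl; exact.
    by move/wl => /(_ zab yab); rewrite distrC.
  rewrite expr1 mulrA ler_pM2r ?invr_gt0 //.
  have [-> |yz'] := eqVneq y z; first by rewrite subrr normr0 mulr_ge0.
  have {yz'} yz : y < z by rewrite lt_neqAle yz'.
  have so := subset_open_segment yab zab; have sc := subset_segment yab zab.
  have [t tyz ->] := MVT yz (fun t tyz => hd 0%N isT t (so t tyz))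
    (continuous_subspaceW sc (hc 0%N isT)).
  have tab := sc _ (subset_itv_oo_cc tyz).
  rewrite normrM; apply: ler_pM => //; first exact: hM.
  move: yab zab; rewrite !in_itv /= => /andP[? ?] /andP[? ?].
  by rewrite ger0_norm; lra.
set m := size (c :: s) in hd hc hM *.
have f0 : (0 : R) < m`!%:R by rewrite ltr0n fact_gt0.
(* One zero is kept as the centre; the distance to each of the others is bounded
   by the length of the interval. *)
pose K := M / m`!%:R * (b - a) ^+ (size s).
have K0 : 0 <= K by rewrite /K mulr_ge0 ?exprn_ge0 // divr_ge0.
have [cab sab'] := andP sab.
have hK t : t \in `[a, b] -> `|g 1%N t| <= K * `|t - c|.
  move=> tab.
  have := @interpolation_bound R (fun i => g i.+1) a b M (c :: s) t.
  move=> /(_ (fun i im => hd i.+1 im) (fun i im => hc i.+1 im) hM us sab hs tab).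
  move/le_trans; apply; rewrite -[size _]/m big_cons /K.
  rewrite -!mulrA; apply: ler_wpM2l => //; apply: ler_wpM2l.
    by rewrite invr_ge0 ltW.
  rewrite mulrC; apply: ler_wpM2r => //.
  have -> : (b - a) ^+ size s = \prod_(d <- s) (b - a).
    by rewrite big_const_seq count_predT iter_mulr_1.
  rewrite big_seq [leRHS]big_seq; apply: ler_prod => d ds.
  rewrite normr_ge0 /= ler_norml.
  have := allP sab' d ds; move: tab; rewrite /= !in_itv /=.
  by move=> /andP[? ?] /andP[? ?]; apply/andP; split; lra.
have := @increment_le_sqr (g 0%N) (g 1%N) a b c K y z K0 cab (hd 0%N isT) (hc 0%N isT).
move=> /(_ (fun t tab => hK t (subset_itv_oo_cc tab)) yab zab) h.
have -> : M * ((b - a) / 2) ^+ m.+1 = (M * (b - a) ^+ m.+1 / 2 ^+ m) / 2.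
  by rewrite expr_div_n [2 ^+ m.+1]exprS; field; rewrite expf_neq0.
rewrite ler_pM2r ?invr_gt0 //; apply: le_trans h _.
have -> : K / 2 * (b - a) ^+ 2 = M * (b - a) ^+ m.+1 / (2 * m`!%:R).
  have -> : (b - a) ^+ m.+1 = (b - a) ^+ size s * (b - a) ^+ 2.
    by rewrite -exprD addn2.
  by rewrite /K; field; rewrite gt_eqF.
apply: ler_wpM2l; first by rewrite mulr_ge0 // exprn_ge0.
rewrite lef_pV2 ?posrE ?exprn_gt0 ?mulr_gt0 //.
by rewrite -natrX -natrM ler_nat; exact: exp2_le_double_fact.
Qed.

End Oscillation.

(** * Maps of class C^l on the unit interval *)

Section SmoothMaps.
Context {R : realType}.
Implicit Types (f : R -> R) (x : R) (k l : nat).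

Lemma is_C_is_derive l f k x : is_C l f -> (k < l)%N -> x \in `]0, 1[ ->
  is_derive x (1 : R) (deriven_itv k f) (deriven_itv k.+1 f x).
Proof.
move=> [df _] kl x01; apply: derivable_itv_is_derive => //.
by apply: df => //; exact: subset_itv_oo_cc.
Qed.

Lemma is_C_continuous l f k : is_C l f -> (k <= l)%N ->
  {within `[0, 1], continuous (deriven_itv k f)}.
Proof.
move=> [df cf]; rewrite leq_eqVlt => /predU1P[-> //|kl].
exact: derivable_itv_continuous (df k kl).
Qed.

Lemma deriven_le_C_norm l f k x : is_C l f -> (0 < k <= l)%N ->
  x \in `[0, 1] -> `|deriven_itv k f x| <= C_norm l f.
Proof.
move=> Cf /andP[k0 kl] x01.
apply: (@le_trans _ _ (sup_norm (deriven_itv k f))); last first.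
  have kin : k \in index_iota 1 l.+1 by rewrite mem_index_iota k0.
  exact: (le_bigmax_seq 0 k xpredT (fun j => sup_norm (deriven_itv j f)) kin isT).
apply: ub_le_sup; last by exists x.
have cf : {within `[0, 1], continuous (fun t => `|deriven_itv k f t|)}.
  by move=> t; apply: cvg_norm; exact: is_C_continuous Cf kl t.
have [c _ hc] := EVT_max ler01 cf.
by exists `|deriven_itv k f c| => _ [t t01 <-]; exact: hc.
Qed.

End SmoothMaps.

(** * Pieces of monotonicity *)

Section Pieces.
Context {R : realType}.
Implicit Types (f : R -> R) (a b c d x y z : R) (s : seq R).

(** A point that equals a cut is counted in the piece on its left, whence the
    half-open condition in [cuts]. *)
Definition piece_index s y := count (fun c => c < y) s.

Definition cuts s a b := [seq c <- s | a <= c < b].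

Lemma piece_index_le s y z : y <= z -> (piece_index s y <= piece_index s z)%N.
Proof. by move=> yz; apply: sub_count => c /= /lt_le_trans; apply. Qed.

Lemma piece_index_cuts s a b : a <= b ->
  piece_index s b = (piece_index s a + size (cuts s a b))%N.
Proof.
move=> ab; rewrite /piece_index /cuts size_filter; elim: s => //= c s ->.
by rewrite addnACA; congr addn; case: (ltP c a) => //= ca;
  rewrite (lt_le_trans ca ab).
Qed.

Lemma piece_index_bounds x s y : path <%R x s -> x <= y <= last x s ->
  s != [::] -> [/\ (piece_index s y < size s)%N,
    nth 0 (x :: s) (piece_index s y) <= y &
    y <= nth 0 s (piece_index s y)].
Proof.
elim: s x => // c s ih x /= /andP[xc cs] /andP[xy ys] _.
case: (ltP c y) => cy; last first.
  suff -> : piece_index s y = 0%N by [].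
  apply/eqP; rewrite -leqn0 leqNgt -has_count; apply/hasPn => d ds.
  rewrite -leNgt; apply: le_trans cy _.
  by have /allP/(_ _ ds)/ltW := order_path_min lt_trans cs.
have s0 : s != [::] by apply: contraTneq ys => -> /=; rewrite -ltNge.
by have [|? ? ?] := ih c cs _ s0; [rewrite ltW|split].
Qed.

(** Recursive form of the condition on the pieces, which splits along a
    concatenation. *)
Fixpoint monotone_pieces f x s :=
  if s is c :: s' then monotone_on f x c /\ monotone_pieces f c s' else True.

Lemma monotone_piecesP f x s :
  (forall i, (i < size s)%N -> monotone_on f (nth 0 (x :: s) i) (nth 0 s i)) <->
  monotone_pieces f x s.
Proof.
elim: s x => //= c s ih x; split => [h|[h0 /ih h] [|i] //]; last exact: h.
by split; [exact: (h 0%N)|apply/ih => i; exact: (h i.+1)].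
Qed.

Lemma monotone_pieces_cat f x s1 s2 : monotone_pieces f x (s1 ++ s2) <->
  monotone_pieces f x s1 /\ monotone_pieces f (last x s1) s2.
Proof.
elim: s1 x => [|c s1 ih] x /=; first by split => // -[].
by rewrite ih; split => [[? []]|[[]]].
Qed.

Lemma nondecreasing_glue f a c d : a <= c -> c <= d ->
  {in `[a, c] &, nondecreasing_fun f} -> {in `[c, d] &, nondecreasing_fun f} ->
  {in `[a, d] &, nondecreasing_fun f}.
Proof.
move=> ac cd h1 h2 y z; rewrite !in_itv /= => /andP[ay yd] /andP[az zd] yz.
have [yc|cy] := leP y c; last first.
  by apply: h2 => //; rewrite in_itv /= ?yd ?zd andbT ?(le_trans (ltW cy)) // ltW.
have [zc|cz] := leP z c; first by apply: h1; rewrite // in_itv /= ?ay ?az.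
apply: (@le_trans _ _ (f c)); first by apply: h1; rewrite // in_itv /= ?ay ?ac ?lexx.
by apply: h2; rewrite ?in_itv /= ?lexx ?zd ?cd ?ltW.
Qed.

Lemma nonincreasing_glue f a c d : a <= c -> c <= d ->
  {in `[a, c] &, nonincreasing_fun f} -> {in `[c, d] &, nonincreasing_fun f} ->
  {in `[a, d] &, nonincreasing_fun f}.
Proof.
move=> ac cd h1 h2.
have {}h1 : {in `[a, c] &, nondecreasing_fun (- f)}.
  by move=> y z yi zi yz; rewrite lerN2 h1.
have {}h2 : {in `[c, d] &, nondecreasing_fun (- f)}.
  by move=> y z yi zi yz; rewrite lerN2 h2.
by move=> y z yi zi yz; rewrite -lerN2; exact: (nondecreasing_glue ac cd h1 h2).
Qed.

(** By minimality two adjacent pieces cannot be merged, hence [f] is monotone in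
    opposite directions on them and has a local extremum at their common
    end-point. *)
Lemma cut_critical l f s c : is_C l f -> (0 < l)%N -> monotone_partition f s ->
  (forall s', monotone_partition f s' -> (size s <= size s')%N) ->
  c \in s -> c < 1 -> derive_itv f c = 0.
Proof.
move=> Cf l0 [[ps ls] ms] smin cs c1.
case/splitPr: cs ps ls ms smin => s1 s2.
case: s2 => [|d s2]; first by rewrite last_cat /= => _ /eqP cE; rewrite cE ltxx in c1.
move=> ps ls /monotone_piecesP /monotone_pieces_cat /= [m1 [mac [mcd m2]]] smin.
set a := last 0 s1 in mac.
move: (ps); rewrite cat_path /= -/a => /andP[p1 /and3P[ac cd p2]].
have nmerge : ~ monotone_on f a d.
  move=> mad; suff /smin : monotone_partition f (s1 ++ d :: s2).
    by rewrite !size_cat /= leq_add2l ltnn.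
  split; last by apply/monotone_piecesP/monotone_pieces_cat.
  by split; [rewrite cat_path /= p1 -/a (lt_trans ac) | move: ls; rewrite !last_cat].
have a0 : 0 <= a.
  by rewrite /a; case: (s1) p1 => // e t /(order_path_min lt_trans)/allP h; 
    apply/ltW/h; rewrite /= mem_last.
have d1 : d <= 1.
  have -> : 1 = last d s2 by move: ls; rewrite last_cat /= => /eqP.
  have := order_path_min lt_trans p2; move=> /allP h.
  by have := mem_last d s2; rewrite inE => /predU1P[->//|/h/ltW].
have c01 : c \in `]0, 1[ by rewrite in_itv /= c1 (le_lt_trans a0).
have dc : is_derive c (1 : R) f (derive_itv f c) := is_C_is_derive Cf l0 c01.
have dad t : t \in `]a, d[ -> derivable f t 1.
  rewrite in_itv /= => /andP[at_ td].
  have t01 : t \in `]0, 1[ by rewrite in_itv /= (le_lt_trans a0) // (lt_le_trans td).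
  by have [] := is_C_is_derive Cf l0 t01.
have cad : c \in `]a, d[ by rewrite in_itv /= ac cd.
have adle := ltW (lt_trans ac cd).
have zero : is_derive c (1 : R) f 0 -> derive_itv f c = 0.
  by move=> [_ <-]; have [_ /esym] := dc.
have cc : c \in `[a, c] by rewrite in_itv /= lexx ltW.
have cc' : c \in `[c, d] by rewrite in_itv /= lexx ltW.
case: mac => hac; case: mcd => hcd.
- by case: nmerge; left; exact: nondecreasing_glue (ltW ac) (ltW cd) hac hcd.
- apply/zero/(derive1_at_max adle dad cad) => t /[!in_itv]/= /andP[at_ td].
  have [tc|ct] := leP t c; first by apply: (hac _ _ _ cc tc); rewrite in_itv /= tc ltW.
  by apply: (hcd _ _ cc' _ (ltW ct)); rewrite in_itv /= !ltW.
- apply/zero/(derive1_at_min adle dad cad) => t /[!in_itv]/= /andP[at_ td].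
  have [tc|ct] := leP t c; first by apply: (hac _ _ _ cc tc); rewrite in_itv /= tc ltW.
  by apply: (hcd _ _ cc' _ (ltW ct)); rewrite in_itv /= !ltW.
- by case: nmerge; right; exact: nonincreasing_glue (ltW ac) (ltW cd) hac hcd.
Qed.

End Pieces.

(** * Counting points by itinerary *)

Section Counting.
Context {R : realType}.
Implicit Types (f : R -> R) (A B C : set R) (close : R -> R -> Prop).
Implicit Types (delta : R) (s : seq R) (m n i j : nat).

(** The representatives are taken in [B] rather than in the piece [C], because at
    late times any two points of the whole ball [B] are close. *)
Definition covered close B C m := exists ks : seq R,
  [/\ (size ks <= m)%N, (forall y, y \in ks -> B y) &
      forall x, C x -> exists2 y, y \in ks & close x y].

Lemma covered_union close B C (D : nat -> set R) (qs : seq nat) m :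
  (forall x, C x -> exists2 q, q \in qs & D q x) ->
  (forall q, q \in qs -> covered close B (D q) m) ->
  covered close B C (size qs * m).
Proof.
elim: qs C => [|q qs ih] C hC hD.
  by exists [::]; split => // x /hC [].
have [ks [sk kB kc]] := hD q (mem_head q qs).
have [|q' q'qs|ks' [sk' kB' kc']] := ih (fun x => exists2 q', q' \in qs & D q' x).
- by [].
- by apply: hD; rewrite inE q'qs orbT.
exists (ks ++ ks'); split.
- by rewrite size_cat mulSn leq_add.
- by move=> y; rewrite mem_cat => /orP[/kB|/kB'].
move=> x /hC [q' /[1!inE] /predU1P[->|q'qs] Dx].
  by have [y yk xy] := kc x Dx; exists y; rewrite // mem_cat yk.
have [|y yk xy] := kc' x; first by exists q'.
by exists y; rewrite // mem_cat yk orbT.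
Qed.

Lemma covered_key close B C (h : R -> nat) m : C `<=` B ->
  (forall x, C x -> (h x < m)%N) ->
  (forall x y, C x -> C y -> h x = h y -> close x y) ->
  covered close B C m.
Proof.
move=> CB hm hclose; rewrite -[m in covered _ _ _ m](size_iota 0) -[size _]muln1.
apply: (covered_union (D := fun q x => C x /\ h x = q)) => [x Cx|q _].
  by exists (h x) => //; rewrite mem_iota /= hm.
have [[y [Cy hy]]|none] := pselect (exists y, C y /\ h y = q).
  exists [:: y]; split => //; first by move=> z /[1!inE] /eqP ->; exact: CB.
  by move=> x [Cx hx]; exists y; rewrite ?inE //; apply: hclose; rewrite ?hx ?hy.
by exists [::]; split => // x xq; case: none; exists x.
Qed.

Definition monotone_in C (h : R -> R) :=
  {in C &, nondecreasing_fun h} \/ {in C &, nonincreasing_fun h}.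

Definition orbit_close f n delta (x y : R) :=
  forall j, (j <= n)%N -> `|iter j f x - iter j f y| < delta.

Lemma iter_itv f j x : itv_self_map f -> x \in `[0, 1] -> iter j f x \in `[0, 1].
Proof. by move=> ff x01; elim: j => //= j; exact: ff. Qed.

(** Up to sign, the first iterates are all nondecreasing on [C]; a point of [C]
    is then located with respect to every one of them by the value of their
    sum. *)
Lemma covered_monotone f n delta B C : itv_self_map f -> 0 < delta ->
  B `<=` `[0, 1] -> C `<=` B ->
  (forall j, (j <= n)%N -> monotone_in C (iter j f)) ->
  covered (orbit_close f n delta) B C (Num.truncn (n.+1%:R / delta)).+1.
Proof.
move=> ff d0 B01 CB mono.
have C01 x : C x -> x \in `[0, 1] by move=> /CB/B01.
have /choice[H hH] j : exists H : R -> R, (j <= n)%N ->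
    [/\ {in C &, nondecreasing_fun H}, forall x, C x -> 0 <= H x <= 1 &
        forall x y, `|iter j f x - iter j f y| = `|H y - H x|].
  have [jn|jn] := leqP j n; last by exists (fun=> 0).
  have it01 x : C x -> 0 <= iter j f x <= 1.
    by move=> /C01/(iter_itv j ff); rewrite in_itv.
  case: (mono j jn) => mj.
    by exists (iter j f) => _; split => // x y; rewrite distrC.
  (* Reversing a nonincreasing iterate keeps it in [0, 1]. *)
  exists (fun x => 1 - iter j f x) => _; split.
  - by move=> x y Cx Cy xy; rewrite lerD2l lerN2; exact: mj.
  - by move=> x /it01 /andP[? ?]; rewrite subr_ge0 gerBl; apply/andP.
  - by move=> x y; congr (`|_|); ring.
pose phi x := \sum_(j < n.+1) H j x.
have phi_ge0 x : C x -> 0 <= phi x.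
  move=> Cx; apply: sumr_ge0 => j _.
  by have [_ /(_ x Cx)/andP[]] := hH j (ltn_ord j).
have phi_le x : C x -> phi x <= n.+1%:R.
  move=> Cx; rewrite -[n.+1 in leRHS]card_ord -sumr_const.
  by apply: ler_sum => j _; have [_ /(_ x Cx)/andP[]] := hH j (ltn_ord j).
have H_phi j x y : (j <= n)%N -> C x -> C y -> x <= y -> `|H j y - H j x| <= `|phi y - phi x|.
  move=> jn Cx Cy xy; rewrite -sumrB (bigD1 (Ordinal (jn : (j < n.+1)%N))) //=.
  have inc (i : 'I_n.+1) : 0 <= H i y - H i x.
    by have [h _ _] := hH i (ltn_ord i); rewrite subr_ge0; apply: h => //; rewrite inE.
  have h0 := inc (Ordinal (jn : (j < n.+1)%N)).
  rewrite (ger0_norm h0) ger0_norm; last by rewrite addr_ge0 // sumr_ge0.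
  by rewrite lerDl sumr_ge0.
apply: (covered_key (h := fun x => Num.truncn (phi x / delta))) => //.
  move=> x Cx; rewrite ltnS; apply: le_truncn.
  by rewrite ler_pM2r ?invr_gt0 //; exact: phi_le.
move=> x y Cx Cy hxy j jn.
have [_ _ ->] := hH j jn.
apply: (@le_lt_trans _ _ `|phi y - phi x|).
  by have [xy|/ltW yx] := leP x y; last rewrite distrC [leRHS]distrC; exact: H_phi.
have px := divr_ge0 (phi_ge0 x Cx) (ltW d0).
have py := divr_ge0 (phi_ge0 y Cy) (ltW d0).
have := truncn_itv px; have := truncn_itv py; rewrite hxy.
move=> /andP[y1 y2] /andP[x1 x2].
have : `|phi y / delta - phi x / delta| < 1.
  by rewrite -natr1 in x2 y2; rewrite ltr_norml; apply/andP; split; lra.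
by rewrite -mulrBl normrM normfV (gtr0_norm d0) ltr_pdivrMr // mul1r.
Qed.

Lemma monotone_in_comp f g C a b : monotone_in C g ->
  (forall x, C x -> g x \in `[a, b]) -> monotone_on f a b ->
  monotone_in C (f \o g).
Proof.
move=> mg gab mf.
have gi x : x \in C -> g x \in `[a, b] by rewrite inE; exact: gab.
case: mg => mg; case: mf => mf; [left|right|right|left] => x y Cx Cy xy /=;
  by apply: mf; rewrite ?gi // mg.
Qed.

Lemma monotone_in_sub g C D : D `<=` C -> monotone_in C g -> monotone_in D g.
Proof.
move=> DC [] mg; [left|right] => x y; rewrite !inE => /DC Cx /DC Cy;
  by apply: mg; rewrite inE.
Qed.

(** The induction goes backwards in time: a set on which the iterates up to [i]
    are monotone is cut by the position of its i-th image among the pieces, of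
    which the interval [[a i, b i]] meets one more than it contains cuts. *)
Lemma covered_itinerary f s (a b : nat -> R) n delta B : itv_self_map f ->
  0 < delta -> monotone_partition f s -> B `<=` `[0, 1] ->
  (forall i x, (i < n)%N -> B x -> a i <= iter i f x <= b i) ->
  covered (orbit_close f n delta) B B
    (\prod_(0 <= i < n) (size (cuts s (a i) (b i))).+1 *
     (Num.truncn (n.+1%:R / delta)).+1).
Proof.
move=> ff d0 [[ps ls] ms] B01 ab; set S := (Num.truncn _).+1.
suff key k i C : (i + k = n)%N -> C `<=` B ->
    (forall j, (j <= i)%N -> monotone_in C (iter j f)) ->
    covered (orbit_close f n delta) B C
      (\prod_(i <= i' < n) (size (cuts s (a i') (b i'))).+1 * S).
  apply: (key n 0%N) => // j; rewrite leqn0 => /eqP -> /=; left => x y _ _ //.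
elim: k i C => [|k ih] i C; first rewrite addn0.
  by move=> -> CB mono; rewrite big_geq // mul1n; exact: covered_monotone.
rewrite -addSnnS => ikn CB mono.
have i_n : (i < n)%N by rewrite -ikn leq_addr.
have s0 : s != [::].
  by apply: contraTneq ls => ->; rewrite /= eq_sym oner_eq0.
rewrite big_ltn // -mulnA.
set k' := size _.
rewrite -[k'.+1](size_iota (piece_index s (a i))).
apply: (covered_union (D := fun q x => C x /\ piece_index s (iter i f x) = q)).
  move=> x Cx; exists (piece_index s (iter i f x)) => //.
  have /andP[ax xb] := ab i x i_n (CB x Cx).
  rewrite mem_iota (piece_index_le s ax) addnS ltnS -piece_index_cuts ?(le_trans ax) //.
  exact: piece_index_le.
move=> q _; apply: ih => //; first by move=> x [/CB].
move=> j; rewrite leq_eqVlt => /predU1P[->|]; last first.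
  by rewrite ltnS => /mono; apply: monotone_in_sub => x [].
have [[x0 [Cx0 hq]]|none] := pselect (exists x, C x /\ piece_index s (iter i f x) = q);
    last first.
  by left => x y; rewrite in_setE => Cx; case: none; exists x.
have bounds x : C x -> piece_index s (iter i f x) = q ->
    (q < size s)%N /\ iter i f x \in `[nth 0 (0 :: s) q, nth 0 s q].
  move=> /CB/B01/(iter_itv i ff); rewrite in_itv /= -(eqP ls) => x01 <-.
  by have [? h1 h2] := piece_index_bounds ps x01 s0; rewrite in_itv /= h1.
have [qs _] := bounds x0 Cx0 hq.
apply: (@monotone_in_comp f (iter i f) _ _ _ _ _ (ms q qs)).
  by apply: monotone_in_sub (mono i (leqnn i)) => x [].
by move=> x [Cx xq]; have [] := bounds x Cx xq.
Qed.

End Counting.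

(** * Growth of the number of pieces along a Bowen ball *)

Section Growth.
Context {R : realType}.
Implicit Types (f : R -> R) (B : set R) (x y z eps delta M : R).
Implicit Types (s : seq R) (i k l n N : nat).

Lemma segment_hull (S : set R) : S !=set0 -> S `<=` `[0, 1] ->
  [/\ forall y, S y -> inf S <= y <= sup S, 0 <= inf S & sup S <= 1].
Proof.
move=> S0 S01; have S01' y : S y -> 0 <= y <= 1.
  by move=> /S01; rewrite /= in_itv.
have hs : has_ubound S by exists 1 => y /S01' /andP[].
have hi : has_lbound S by exists 0 => y /S01' /andP[].
split.
- by move=> y Sy; rewrite (ub_le_sup hs) // (ge_inf hi).
- by apply: lb_le_inf => // y /S01' /andP[].
- by apply: ge_sup => // y /S01' /andP[].
Qed.

Lemma sup_sub_inf_le (S : set R) c : S !=set0 ->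
  (forall y z, S y -> S z -> `|z - y| <= c) -> sup S - inf S <= c.
Proof.
move=> S0 Sc; rewrite lerBlDr; apply: ge_sup => // z Sz.
rewrite -lerBlDl; apply: lb_le_inf => // y Sy.
by have := Sc y z Sy Sz; rewrite ler_norml => /andP[_]; lra.
Qed.

(** The hull contains fewer than [l] cuts, so that [half_image_le], applied with
    all of them as zeros of [f'], involves derivatives of order at most [l]
    only. *)
Lemma half_hull_contraction l f s (S : set R) M : is_C l f ->
  monotone_partition f s -> size s = l ->
  (forall s', monotone_partition f s' -> (size s <= size s')%N) ->
  C_norm l f <= M -> S !=set0 -> S `<=` `[0, 1] ->
  (sup (f @` S) - inf (f @` S)) / 2 <=
  M * ((sup S - inf S) / 2) ^+ (size (cuts s (inf S) (sup S))).+1.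
Proof.
move=> Cf mp sl smin CM S0 S01.
have [hull i0 s1] := segment_hull S0 S01.
have is_le : inf S <= sup S by have [y /hull/andP[/le_trans]] := S0; apply.
have [[ps /eqP ls] _] := mp.
have s_nil : s != [::].
  by apply/eqP => s_nil; move: ls; rewrite s_nil /= => /eqP; rewrite eq_sym oner_eq0.
have l0 : (0 < l)%N by rewrite -sl lt0n size_eq0.
have cl : (size (cuts s (inf S) (sup S)) < l)%N.
  have [|lt _ _] := @piece_index_bounds R 0 s (sup S) ps _ s_nil.
    by rewrite ls s1 (le_trans i0).
  by rewrite -sl; apply: leq_ltn_trans lt; rewrite (piece_index_cuts s is_le) leq_addl.
set u := cuts s _ _ in cl *.
have i01 : inf S \in `[0, 1] by rewrite in_itv /= i0 (le_trans is_le).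
have s01 : sup S \in `[0, 1] by rewrite in_itv /= s1 (le_trans i0).
have sc := subset_segment i01 s01; have so := subset_open_segment i01 s01.
rewrite ler_pdivrMr //; apply: sup_sub_inf_le.
  by have [y Sy] := S0; exists (f y), y.
move=> _ _ [y Sy <-] [z Sz <-]; rewrite -ler_pdivrMr //.
apply: (@half_image_le R (deriven_itv^~ f) (inf S) (sup S) M u y z).
- by move=> i iu t tS; apply: is_C_is_derive Cf _ (so t tS); exact: leq_ltn_trans cl.
- move=> i iu; apply: (continuous_subspaceW sc).
  by apply: (is_C_continuous Cf); apply: leq_trans iu (ltnW cl).
- by move=> t tS; apply: le_trans CM; apply: (deriven_le_C_norm Cf) (sc t tS).
- by rewrite filter_uniq //; apply: lt_sorted_uniq; exact: path_sorted ps.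
- apply/allP => c; rewrite mem_filter => /andP[/andP[ic cs] _].
  by rewrite /= in_itv /= ic ltW.
- apply/allP => c; rewrite mem_filter => /andP[/andP[_ c_lt] cs] /=.
  apply/eqP; apply: (cut_critical Cf l0 mp smin cs).
  exact: lt_le_trans c_lt s1.
- by rewrite in_itv; exact: hull.
- by rewrite in_itv; exact: hull.
Qed.

(** With [alpha i = - ln (ell i)] the hypothesis reads
    [k i * alpha i <= alpha i.+1 + ln M <= alpha i.+1 * (1 + ln M / - ln eps)],
    so that the product of the [k i] telescopes. *)
Lemma prod_exponents_le (ell : nat -> R) (k : nat -> nat) N eps M :
  0 < eps < 1 -> 1 <= M ->
  (forall i, (i <= N)%N -> 0 < ell i <= eps) ->
  (forall i, (i < N)%N -> ell i.+1 <= M * ell i ^+ k i) ->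
  (\prod_(0 <= i < N) k i)%:R <=
    ln (ell N) / ln eps * expR (ln M / `|ln eps|) ^+ N.
Proof.
move=> /andP[e0 e1] M1 ellP ellM.
have A0 : 0 < - ln eps by rewrite oppr_gt0 ln_lt0 // e0.
have -> : `|ln eps| = - ln eps by rewrite ltr0_norm // -oppr_gt0.
have M0 : 0 < M by apply: lt_le_trans M1.
have lM0 : 0 <= ln M by rewrite ln_ge0.
set E := expR _.
have alpha_ge i : (i <= N)%N -> - ln eps <= - ln (ell i).
  by move=> /ellP /andP[l0 le]; rewrite lerN2 ler_ln ?posrE.
have step i : (i < N)%N -> (k i)%:R * - ln (ell i) <= - ln (ell i.+1) * E.
  move=> iN; have /andP[l0 _] := ellP i (ltnW iN); have /andP[l0' _] := ellP i.+1 iN.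
  have := ellM i iN.
  rewrite -(@ler_ln R) ?posrE ?mulr_gt0 ?exprn_gt0 //.
  rewrite lnM ?posrE ?exprn_gt0 // lnXn // -mulr_natl => h.
  have a_ge := alpha_ge i.+1 iN.
  apply: (@le_trans _ _ (- ln (ell i.+1) * (1 + ln M / - ln eps))).
    rewrite mulrDr mulr1.
    suff : ln M <= - ln (ell i.+1) * (ln M / - ln eps) by move: h; lra.
    rewrite mulrCA ler_peMr // ler_pdivlMr // mul1r //.
  by apply: ler_wpM2l; [exact: le_trans (ltW A0) a_ge|exact: expR_ge1Dx].
have prodP n : (n <= N)%N ->
    (\prod_(0 <= i < n) k i)%:R * - ln (ell 0) <= - ln (ell n) * E ^+ n.
  elim: n => [|n ih] nN; first by rewrite big_geq // mul1r expr0 mulr1.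
  rewrite big_nat_recr //= natrM mulrAC exprSr mulrA.
  apply: (@le_trans _ _ (- ln (ell n) * E ^+ n * (k n)%:R)).
    by apply: ler_wpM2r => //; exact: ih (ltnW nN).
  rewrite mulrAC [leRHS]mulrAC; apply: ler_wpM2r; first by rewrite exprn_ge0 // expR_ge0.
  by rewrite mulrC step.
have := prodP N (leqnn N).
set P := _%:R => h.
have PA : P * - ln eps <= - ln (ell N) * E ^+ N.
  by apply: le_trans h; apply: ler_wpM2l; [rewrite /P|exact: alpha_ge].
rewrite -(ler_pM2r A0); apply: le_trans PA _.
by rewrite le_eqVlt; apply/orP; left; apply/eqP; field; rewrite -oppr_eq0 gt_eqF.
Qed.

Lemma last_index (P : nat -> Prop) n :
  (exists2 N, (N < n)%N & P N /\ forall j, (N < j < n)%N -> ~ P j) \/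
  (forall j, (j < n)%N -> ~ P j).
Proof.
elim: n => [|n ih]; first by right.
have [Pn|nPn] := pselect (P n).
  by left; exists n => //; split => // j; lia.
case: ih => [[N Nn [PN hN]]|h]; [left; exists N; first exact: ltnW|right].
  split => // j /andP[Nj]; rewrite ltnS leq_eqVlt => /predU1P[-> //|jn].
  by apply: hN; rewrite Nj.
by move=> j; rewrite ltnS leq_eqVlt => /predU1P[-> //|]; exact: h.
Qed.

Lemma covered_sub (close close' : R -> R -> Prop) B C m :
  (forall x y, C x -> B y -> close x y -> close' x y) ->
  covered close B C m -> covered close' B C m.
Proof.
move=> sub [ks [sk kB kc]]; exists ks; split => // x Cx.
by have [y yk xy] := kc x Cx; exists y => //; apply: sub => //; exact: kB.
Qed.

(** Past the last time [N] at which the image of the ball is [delta]-large, its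
    points need no longer be told apart.  At time [N] the half-length is at
    least [delta / 2], which bounds the boundary term of the telescoped
    product. *)
Lemma covered_bowen_ball l f eps delta n x : (0 < l)%N ->
  itv_self_map f -> is_C l f -> multimodal l f -> 0 < eps < 1 -> 0 < delta ->
  x \in `[0, 1] ->
  exists2 m, covered (fun y z => forall i, (i < n)%N ->
      `|iter i f y - iter i f z| < delta)
    (bowen_ball n f x eps) (bowen_ball n f x eps) m &
  m%:R <= (1 + `|ln (delta / 2) / ln eps|) *
    expR (ln_plus (C_norm l f) / `|ln eps|) ^+ n * (1 + n%:R / delta).
Proof.
move=> l0 ff Cf [_ [s mp sl] smin] /andP[e0 e1] d0 x01.
rewrite -sl in smin.
set B := bowen_ball n f x eps; set E := expR _.
have E1 : 1 <= E by rewrite -expR0 ler_expR divr_ge0 // /ln_plus le_max lexx orbT.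
have B01 : B `<=` `[0, 1] by move=> y [].
have Bx : B x by split => // i _; rewrite subrr normr0.
pose S i := iter i f @` B.
have S0 i : S i !=set0 by exists (iter i f x), x.
have S01 i : S i `<=` `[0, 1] by move=> _ [y /B01 y01 <-]; exact: iter_itv.
have SS i : S i.+1 = f @` S i by rewrite /S image_comp.
pose ell i := (sup (S i) - inf (S i)) / 2.
pose k i := (size (cuts s (inf (S i)) (sup (S i)))).+1.
have hull i y : B y -> inf (S i) <= iter i f y <= sup (S i).
  by move=> By; have [h _ _] := segment_hull (S0 i) (S01 i); apply: h; exists y.
have diam i y z : B y -> B z -> `|iter i f y - iter i f z| <= ell i * 2.
  move=> /(hull i) /andP[? ?] /(hull i) /andP[? ?].
  by rewrite /ell divfK // ler_norml; apply/andP; split; lra.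
have ell0 i : 0 <= ell i.
  by have := diam i x x Bx Bx; rewrite subrr normr0 pmulr_lge0.
have elle i : (i < n)%N -> ell i <= eps.
  move=> iN; rewrite /ell ler_pdivrMr //; apply: sup_sub_inf_le => //.
  move=> _ _ [y [_ /(_ i iN) hy] <-] [z [_ /(_ i iN) hz] <-].
  have -> : iter i f z - iter i f y =
    (iter i f z - iter i f x) - (iter i f y - iter i f x) by ring.
  apply: le_trans (ler_normB _ _) _.
  by rewrite mulr_natr mulr2n lerD // ltW.
(* Without a [delta]-large time, the centre alone represents the ball. *)
have [[N Nn [dN hN]]|small] := last_index (fun i => delta <= ell i * 2) n; last first.
  exists 1%N.
    exists [:: x]; split => //; first by move=> y /[1!inE] /eqP ->.
    move=> y By; exists x; rewrite ?inE // => i iN.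
    by apply: le_lt_trans (diam i y x By Bx) _; rewrite ltNge; apply/negP; exact: small.
  have h1 : 1 <= 1 + n%:R / delta by rewrite lerDl divr_ge0 // ltW.
  have h2 : 1 <= 1 + `|ln (delta / 2) / ln eps| by rewrite lerDl.
  by rewrite -[leLHS]mulr1 -[X in X * 1]mulr1 !ler_pM // ?mulr_ge0 // exprn_ege1.
pose M := Num.max 1 (C_norm l f).
have lM : ln M = ln_plus (C_norm l f).
  rewrite /M /ln_plus; have [c0|c0] := leP (C_norm l f) 0.
    rewrite (max_idPl _); last by apply: le_trans c0 ler01.
    by rewrite ln1 ln0 // maxxx.
  rewrite [RHS]maxC; have [c1|c1] := leP 1 (C_norm l f).
    by rewrite (max_idPr _) // ln_ge0.
  by rewrite ln1 (max_idPl _) //; apply/ltW; rewrite ln_lt0 // c0.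
have contr i : ell i.+1 <= M * ell i ^+ k i.
  rewrite /ell SS; apply: (half_hull_contraction Cf mp sl smin) => //.
  by rewrite le_max lexx orbT.
(* The hull at time [N] is not a point, hence neither are the earlier ones. *)
have ellN i : (i <= N)%N -> 0 < ell i.
  move=> iN; rewrite -(subKn iN); elim: (N - i)%N (leq_subr i N) => [|j ih] jN.
    by rewrite subn0 -(pmulr_lgt0 _ (_ : 0 < 2)) //; exact: lt_le_trans dN.
  rewrite lt_neqAle ell0 andbT eq_sym; apply/eqP => z.
  have := ih (ltnW jN); have -> : (N - j = (N - j.+1).+1)%N by lia.
  by rewrite ltNge => /negP; apply; apply: le_trans (contr _) _; rewrite z expr0n mulr0.
have e01 : 0 < eps < 1 by rewrite e0.
have := @prod_exponents_le ell k N eps M e01.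
rewrite lM -/E => /(_ _ _ (fun i _ => contr i)) prodE.
exists (\prod_(0 <= i < N) k i * (Num.truncn (N.+1%:R / delta)).+1)%N.
  apply: covered_sub (covered_itinerary (a := fun i => inf (S i)) (b := fun i => sup (S i)) ff d0 mp B01 _).
    move=> y z By Bz yz i iN; have [|Ni] := leqP i N; first exact: yz.
    apply: le_lt_trans (diam i y z By Bz) _; rewrite ltNge; apply/negP/hN.
    by rewrite Ni.
  by move=> i y _; exact: hull.
rewrite natrM; apply: ler_pM => //.
  apply: le_trans (prodE _ _) _; first by rewrite le_max lexx.
    by move=> i iN; rewrite ellN // elle // (leq_ltn_trans iN).
  have lneps : ln eps < 0 by rewrite ln_lt0.
  apply: ler_pM.
  - by rewrite mulr_le0 ?invr_le0 ?(ltW lneps) // ltW // ln_lt0 // ellN // (le_lt_trans (elle _ Nn)).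
  - by rewrite exprn_ge0 // expR_ge0.
  - apply: (@le_trans _ _ (ln (delta / 2) / ln eps)).
      rewrite ler_nM2r ?invr_lt0 // ler_ln ?posrE ?ellN ?divr_gt0 //.
      by rewrite ler_pdivrMr.
    by apply: le_trans (ler_norm _) _; rewrite lerDr.
  - by rewrite ler_weXn2l // ltnW.
rewrite -natr1 addrC lerD2l.
apply: (@le_trans _ _ (N.+1%:R / delta)).
  by rewrite truncn_le // divr_ge0 // ltW.
by rewrite ler_pM2r ?invr_gt0 // ler_nat.
Qed.

End Growth.

(** * From spanning sets to tail entropy *)

Section Entropy.
Context {R : realType}.
Implicit Types (f : R -> R) (B : set R) (x y eps delta : R) (l m n : nat).

Lemma span_card_le f n delta A m :
  covered (fun x y => forall i, (i < n)%N -> `|iter i f x - iter i f y| < delta)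
    `[0, 1] A m ->
  (span_card n f A delta <= m%:R%:E)%E.
Proof.
move=> [ks [sk k01 kc]]; apply: ge_ereal_inf; exists (size (undup ks))%:R%:E.
  exists (size (undup ks)) => //=; exists [set` ks]; split; last by split.
  have /card_eq_fsetP := finmap.size_seq_fset tt ks.
  congr (is_true (_ #= _)%card).
  by apply/seteqP; split => y; rewrite /= (finmap.seq_fsetE tt ks y).
by rewrite lee_fin ler_nat (leq_trans (size_undup ks)).
Qed.

Lemma le_lne (a b : \bar R) : (a <= b -> lne a <= lne b)%E.
Proof.
move=> ab; have [a0|/ltW a0] := leP a 0%E; first by rewrite le0_lneNy // leNye.
by rewrite lee_lne // in_itv /= leey ?andbT // (le_trans a0).
Qed.

Lemma le_limn_esup (u v : (\bar R)^nat) :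
  (forall n, (u n <= v n)%E) -> (limn_esup u <= limn_esup v)%E.
Proof.
move=> uv; apply: le_ereal_inf_tmp => _ [V FV <-].
apply: ge_ereal_inf; exists (ereal_sup (u @` V)); first by exists V.
apply: ge_ereal_sup => _ [n Vn <-]; apply: le_trans (uv n) _.
by apply: ereal_sup_ubound; exists n.
Qed.

(** The logarithm of the linear factor is absorbed by an arbitrarily small
    linear term, through [1 + a n <= (1 + a / h) (1 + h n)]. *)
Lemma limn_esup_le_exp_rate (u : (\bar R)^nat) (C E a : R) :
  0 < C -> 0 <= a ->
  (forall n, (0 < n)%N ->
     (u n <= (n%:R^-1 * ln (C * expR E ^+ n * (1 + n%:R * a)))%:E)%E) ->
  (limn_esup u <= E%:E)%E.
Proof.
move=> C0 a0 hu; apply/lee_addgt0Pr => e e0.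
pose h := e / 2; have h0 : 0 < h by rewrite divr_gt0.
pose c := ln C + ln (1 + a / h).
pose N := (Num.truncn (`|c| / h)).+1.
apply: ge_ereal_inf; exists (ereal_sup (u @` [set n | (N <= n)%N])).
  by exists [set n | (N <= n)%N] => //; exists N.
apply: ge_ereal_sup => _ [n /= Nn <-].
have n0 : (0 < n)%N by apply: leq_trans Nn.
have n0R : (0 : R) < n%:R by rewrite ltr0n.
apply: le_trans (hu n n0) _; rewrite -EFinD lee_fin.
rewrite mulrC ler_pdivrMr //.
have na0 : 0 <= n%:R * a by rewrite mulr_ge0.
have ah0 : 0 <= a / h by rewrite divr_ge0 // ltW.
have nh0 : 0 <= h * n%:R by rewrite mulr_ge0 // ltW.
have cn : c <= h * n%:R.
  apply: le_trans (ler_norm _) _; rewrite mulrC -ler_pdivrMr //.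
  apply: (@le_trans _ _ N%:R); last by rewrite ler_nat.
  by apply/ltW; have /andP[] := truncn_itv (divr_ge0 (normr_ge0 c) (ltW h0)).
have split_lin : ln (1 + n%:R * a) <= ln (1 + a / h) + h * n%:R.
  apply: (@le_trans _ _ (ln ((1 + a / h) * (1 + h * n%:R)))).
    rewrite ler_ln ?posrE; [|lra|apply: mulr_gt0; lra].
    have -> : (1 + a / h) * (1 + h * n%:R) =
       1 + n%:R * a + (a / h + h * n%:R) by field; rewrite gt_eqF.
    by rewrite lerDl addr_ge0.
  rewrite lnM ?posrE; [|lra|lra].
  by rewrite lerD2l; apply: le_ln1Dx; lra.
have En0 : 0 < expR E ^+ n by rewrite exprn_gt0 // expR_gt0.
rewrite lnM ?posrE; [|exact: mulr_gt0|lra].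
rewrite lnM ?posrE // lnXn ?expR_gt0 // expRK -[E *+ n]mulr_natr.
have -> : (E + e) * n%:R = E * n%:R + h * n%:R + h * n%:R by rewrite /h; field.
by rewrite /c in cn; lra.
Qed.

Lemma span_card_nonincreasing f n A delta delta' : delta <= delta' ->
  (span_card n f A delta' <= span_card n f A delta)%E.
Proof.
move=> dd'; apply: ereal_inf_le_tmp => _ [m [K [Km [K01 Kc]]] <-].
exists m => //; exists K; split => //; split => // x /Kc[y Ky xy].
by exists y => // i /xy/lt_le_trans; apply.
Qed.

End Entropy.

Theorem theorem5 (R : realType) (l : nat) (f : R -> R) (eps : R) :
  (1 <= l)%N ->
  itv_self_map f -> is_C l f -> multimodal l f ->
  0 < eps < 1 ->
  (tail_entropy f eps <= (ln_plus (C_norm l f) / `|ln eps|)%:E)%E.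
Proof.
move=> l0 ff Cf mf e01.
have scale_ge0 n : (0 <= (n%:R^-1 : R)%:E)%E by rewrite lee_fin invr_ge0.
apply: lime_le.
  apply: nonincreasing_at_right_is_cvge; near=> d0 => d1 d2 _ _ d12.
  apply: le_limn_esup => n; apply: lee_wpmul2l => //; apply: le_lne.
  apply: ge_ereal_sup => _ [x x01 <-].
  apply: le_trans (span_card_nonincreasing f n _ d12) _.
  by apply: ereal_sup_ubound; exists x.
near=> delta; have d0 : 0 < delta by near: delta; exact: nbhs_right_gt.
set E := _ / _.
pose C := 1 + `|ln (delta / 2) / ln eps|.
have C0 : 0 < C by rewrite /C ltr_pwDl.
apply: (@limn_esup_le_exp_rate R _ C E delta^-1 C0).
  by rewrite invr_ge0 ltW.
move=> n n0.
have W0 : 0 < C * expR E ^+ n * (1 + n%:R / delta).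
  by rewrite !mulr_gt0 ?exprn_gt0 ?expR_gt0 // ltr_pwDl // divr_ge0 // ltW.
rewrite EFinM; apply: lee_wpmul2l => //; rewrite -lne_EFin //; apply: le_lne.
apply: ge_ereal_sup => _ [x x01 <-].
have [m cm mle] := covered_bowen_ball n l0 ff Cf mf e01 d0 x01.
apply: (@le_trans _ _ m%:R%:E); last by rewrite lee_fin.
apply: span_card_le; case: cm => ks [sk kB kc]; exists ks; split => // y /kB.
by case.
Unshelve. all: by end_near.
Qed.
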